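(* Let $E\subseteq\mathbb{R}$ be a compact set, let $\mu$ be any finite, positive Borel measure with support equal to $E$, and let $e\in E$. Let $\delta_e$ denote the unit point mass at $e$. Then $\mu+\delta_e$ has support $E$ and $\dim_L(\mu+\delta_e)=0$. Moreover, if $e$ is not an isolated point of $E$, then $\dim_A(\mu+\delta_e)=\infty$.
   Context: $B(x,R)$ is the open ball with centre $x$ and radius $R$. The upper and lower Assouad dimensions of a finite, positive Borel measure $\nu$ with support $\operatorname{supp}\nu$ are $$\dim_A\nu=\inf\Big\{\alpha:(\exists C_1,C_2>0)(\forall\,0<r\le R\le C_1)\ \sup_{x\in\operatorname{supp}\nu}\frac{\nu(B(x,R))}{\nu(B(x,r))}\le C_2\Big(\frac Rr\Big)^{\alpha}\Big\},$$ with the convention $\inf\emptyset=\infty$, and $$\dim_L\nu=\sup\Big\{\alpha:(\exists C_1,C_2>0)(\forall\,0<r<R<C_1)\ \inf_{x\in\operatorname{supp}\nu}\frac{\nu(B(x,R))}{\nu(B(x,r))}\ge C_2\Big(\frac Rr\Big)^{\alpha}\Big\}.$$ *)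

(* Defs.v *)
From HB Require Import structures.
From mathcomp Require Import all_boot all_order all_algebra.
From mathcomp Require Import all_classical all_reals all_analysis.

Set Implicit Arguments.
Unset Strict Implicit.
Unset Printing Implicit Defensive.
Import Order.TTheory GRing.Theory Num.Theory.
Import numFieldNormedType.Exports.

Local Open Scope classical_set_scope.
Local Open Scope ring_scope.

(* The library makes [measure_add] a measure only; we need that it preserves
   finiteness. *)
Section measure_add_finite.
Context d (T : measurableType d) (R : realType).
Variables m1 m2 : {finite_measure set T -> \bar R}.

Let measure_add_fin : fin_num_fun (measure_add m1 m2).
Proof.
by move=> A mA; rewrite measure_addE fin_numD !fin_num_measure.
Qed.

HB.instance Definition _ := Measure.on (measure_add m1 m2).
HB.instance Definition _ :=
  Measure_isFinite.Build _ _ _ (measure_add m1 m2) measure_add_fin.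

End measure_add_finite.

Section assouad.
Context {R : realType}.
(* [R] carries its Borel sigma-algebra. *)
Implicit Types nu : {finite_measure set R -> \bar R}.

Local Open Scope ereal_scope.

(* Only open neighbourhoods are tested, since [nu] is unspecified on
   non-measurable sets. *)
Definition msupport nu : set R :=
  [set x | forall U : set R, open_nbhs x U -> 0 < nu U].

(* The quotients are taken in [\bar R]; for [x] in the support they are
   quotients of positive real numbers. The supremum may be [+oo]. *)
Definition upper_assouad_dim nu : \bar R :=
  ereal_inf [set alpha%:E | alpha in [set alpha : R |
    exists C1 C2 : R, [/\ (0 < C1)%R, (0 < C2)%R &
      forall r s : R, (0 < r)%R -> (r <= s)%R -> (s <= C1)%R ->
        ereal_sup [set nu (ball x s) / nu (ball x r) | x in msupport nu]
          <= (C2 * (s / r) `^ alpha)%:E]]].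

Definition lower_assouad_dim nu : \bar R :=
  ereal_sup [set alpha%:E | alpha in [set alpha : R |
    exists C1 C2 : R, [/\ (0 < C1)%R, (0 < C2)%R &
      forall r s : R, (0 < r)%R -> (r < s)%R -> (s < C1)%R ->
        (C2 * (s / r) `^ alpha)%:E
          <= ereal_inf [set nu (ball x s) / nu (ball x r) | x in msupport nu]]]].

End assouad.

(* Main.v *)
Require Import Defs.
From HB Require Import structures.
From mathcomp Require Import all_boot all_order all_algebra.
From mathcomp Require Import all_classical all_reals all_analysis.

Import Order.TTheory GRing.Theory Num.Theory.
Import numFieldNormedType.Exports.
Local Open Scope classical_set_scope.
Local Open Scope ring_scope.

(** At an atom e the mass of a ball stays between nu {e} and the total mass,
    so no positive exponent is admissible for the lower dimension.  If e is
    also a limit point of the support, take x in the support with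
    r = |x - e| small: the ball of radius 2r at x contains the atom, while the
    ball of radius r at x lies in a punctured ball at e, whose mass tends to 0.
    Hence the doubling quotients at scale r are unbounded. *)

Lemma measurable_ball_real (R : realType) (x r : R) :
  measurable (ball x r : set R).
Proof. by apply: measurable_realfun.open_measurable; exact: ball_open. Qed.

Lemma msupport_gt0 (R : realType) (nu : {finite_measure set R -> \bar R})
    (x r : R) :
  msupport nu x -> 0 < r -> (0 < nu (ball x r))%E.
Proof. by move=> sx r0; apply: sx; exact: ball_open_nbhs. Qed.

Lemma atom_msupport (R : realType) (nu : {finite_measure set R -> \bar R})
    (e : R) :
  (0 < nu [set e])%E -> msupport nu e.
Proof.
move=> ae U [oU Ue]; apply: (lt_le_trans ae); apply: le_measure.
- by rewrite inE; exact: measurable_set1.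
- by rewrite inE; exact: measurable_realfun.open_measurable.
- by move=> _ ->.
Qed.

(** Exponent [0] is admissible with both constants equal to [1], because concentric balls are
    nested. *)
Lemma lower_assouad_dim_ge0 (R : realType)
    (nu : {finite_measure set R -> \bar R}) :
  (0 <= lower_assouad_dim nu)%E.
Proof.
apply: ereal_sup_ubound; exists 0 => //; exists 1, 1; split => // r s r0 rs _.
rewrite powRr0 mulr1; apply: le_ereal_inf_tmp => _ [x sx <-].
have p0 := msupport_gt0 _ _ _ _ sx r0.
have fp : nu (ball x r) \is a fin_num.
  by apply: fin_num_measure; exact: measurable_ball_real.
(* Division in [\bar R] reduces to real division once the denominator is known to be finite and
   nonzero. *)
rewrite -(fineK fp) inver gt_eqF; last by rewrite fine_gt0// p0 ltey_eq fp.
rewrite lee_pdivlMr; last by rewrite fine_gt0// p0 ltey_eq fp.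
rewrite mul1e fineK//; apply: le_measure.
- by rewrite inE; exact: measurable_ball_real.
- by rewrite inE; exact: measurable_ball_real.
- by apply: le_ball; exact: ltW.
Qed.

Lemma lower_assouad_dim_atom (R : realType)
    (nu : {finite_measure set R -> \bar R}) (e : R) :
  (0 < nu [set e])%E -> lower_assouad_dim nu = 0%E.
Proof.
move=> ae; apply/eqP; rewrite eq_le lower_assouad_dim_ge0 andbT.
apply: ge_ereal_sup => _ [alpha [C1 [C2 [C10 C20 H]]] <-].
rewrite lee_fin leNgt; apply/negP => alpha0.
have fT : nu setT \is a fin_num by apply: fin_num_measure.
have fa : nu [set e] \is a fin_num.
  by apply: fin_num_measure; exact: measurable_set1.
have a0 : 0 < fine (nu [set e]) by rewrite fine_gt0// ae ltey_eq fa.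
(* [M] bounds every quotient centred at [e], whatever the two radii. *)
set M := fine (nu setT) / fine (nu [set e]).
have M0 : 0 <= M by rewrite divr_ge0// fine_ge0.
pose t := (M / C2 + 2) `^ alpha^-1.
have t1 : 1 < t.
  rewrite (_ : 1 = 1 `^ alpha^-1); last by rewrite powR1.
  rewrite gt0_ltr_powR ?invr_gt0// ?nnegrE//.
    by rewrite addr_ge0// divr_ge0// ltW.
  by rewrite ltr_wpDl ?ltr1n// divr_ge0// ltW.
have t0 : 0 < t by exact: lt_trans t1.
have tE : C2 * t `^ alpha = M + 2 * C2.
  rewrite -powRrM mulVf ?gt_eqF// powRr1; last by rewrite addr_ge0// divr_ge0// ltW.
  by rewrite mulrDr mulrCA divff ?gt_eqF// mulr1 (mulrC C2).
have s0 : 0 < C1 / 2 by rewrite divr_gt0.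
have r0 : 0 < C1 / 2 / t by rewrite divr_gt0.
have := H (C1 / 2 / t) (C1 / 2) r0.
rewrite ltr_pdivrMr// ltr_pMr// t1 => /(_ isT).
rewrite ltr_pdivrMr// ltr_pMr// ltr1n => /(_ isT).
rewrite invf_div mulrCA divff ?gt_eqF// mulr1 tE.
apply/negP; rewrite -ltNge.
apply: (@le_lt_trans _ _ M%:E); last by rewrite lte_fin ltrDl mulr_gt0.
apply: (@le_trans _ _ (nu (ball e (C1 / 2)) / nu (ball e (C1 / 2 / t)))%E).
  by apply: ereal_inf_lbound; exists e => //; exact: atom_msupport.
have aB : (nu [set e] <= nu (ball e (C1 / 2 / t)))%E.
  apply: le_measure.
  - by rewrite inE; exact: measurable_set1.
  - by rewrite inE; exact: measurable_ball_real.
  - by move=> _ ->; exact: ballxx.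
have fB r : nu (ball e r) \is a fin_num.
  by apply: fin_num_measure; exact: measurable_ball_real.
have b0 : 0 < fine (nu (ball e (C1 / 2 / t))).
  by apply: lt_le_trans a0 _; rewrite fine_le.
rewrite -(fineK (fB (C1 / 2 / t))) inver gt_eqF// -(fineK (fB (C1 / 2))).
rewrite -EFinM lee_fin /M ler_pM ?fine_ge0//.
- by rewrite invr_ge0 ltW.
- rewrite fine_le//; apply: le_measure; rewrite ?inE//.
  exact: measurable_ball_real.
- by rewrite lef_pV2 ?posrE// fine_le.
Qed.

(** Continuity from above: the punctured balls of radius [1/(n+1)] decrease to the empty set, and
    [nu] is finite. *)
Lemma punctured_ball_measure (R : realType)
    (nu : {finite_measure set R -> \bar R}) (e eps : R) :
  0 < eps ->
  exists2 d, 0 < d & (nu (ball e d `\ e) < eps%:E)%E.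
Proof.
move=> eps0.
pose F n : set R := ball e n.+1%:R^-1 `\ e.
have mF n : measurable (F n).
  by apply: measurableD; [exact: measurable_ball_real|exact: measurable_set1].
have F0 : \bigcap_n F n = set0.
  rewrite -subset0 => x Fx.
  have xe : x != e by apply/eqP; case: (Fx 0 I).
  have d0 : 0 < `|e - x| by rewrite normr_gt0 subr_eq0 eq_sym.
  have [n _ /(_ n (leqnn n)) /=] := near_infty_natSinv_lt (PosNum d0).
  by case: (Fx n I); rewrite -ball_normE /= => h _ /(lt_trans h); rewrite ltxx.
have := @nonincreasing_cvg_mu _ _ _ nu F.
rewrite F0 measure0 => cF.
have : (nu \o F) n @[n --> \oo] --> 0%E.
  apply: cF => //.
  - by rewrite ltey_eq fin_num_measure.
  - move=> n m nm; apply/subsetPset; apply: setSD.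
    by apply: le_ball; rewrite lef_pV2 ?posrE// ler_nat.
move=> /fine_cvgP[_ /cvgr_lt /(_ eps eps0)] [n _ /(_ n (leqnn n)) /= h].
exists n.+1%:R^-1; first by rewrite invr_gt0.
by rewrite -(fineK (fin_num_measure nu (F n) (mF n))) lte_fin.
Qed.

Lemma upper_assouad_dim_atom (R : realType)
    (nu : {finite_measure set R -> \bar R}) (e : R) :
  (0 < nu [set e])%E -> limit_point (msupport nu) e ->
  upper_assouad_dim nu = +oo%E.
Proof.
move=> ae lim_e.
(* No exponent is admissible, and the infimum of the empty set is [+oo]. *)
rewrite /upper_assouad_dim (_ : [set _ | _] = set0) ?image_set0 ?ereal_inf0//.
rewrite -subset0 => alpha [C1 [C2 [C10 C20 H]]].
have fa : nu [set e] \is a fin_num.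
  by apply: fin_num_measure; exact: measurable_set1.
have a0 : 0 < fine (nu [set e]) by rewrite fine_gt0// ae ltey_eq fa.
(* This is the bound that [H] would impose on quotients with radii [r] and [2r]. *)
have K0 : 0 < C2 * 2 `^ alpha by rewrite mulr_gt0// powR_gt0.
have [d d0 hd] :=
  @punctured_ball_measure R nu e _ (divr_gt0 a0 K0).
(* Halving leaves room for the doubled radius: [2r] stays below both [d] and [C1]. *)
have m0 : 0 < Num.min d C1 / 2 by rewrite divr_gt0// lt_min d0.
have [x [xe sx]] := lim_e _ (nbhsx_ballx e _ m0).
rewrite -ball_normE /= => exm.
set r := `|e - x|.
have r0 : 0 < r by rewrite normr_gt0 subr_eq0 eq_sym.
have [rd rC] : r * 2 < d /\ r * 2 < C1.
  by move: exm; rewrite ltr_pdivlMr// lt_min => /andP.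
have := H r (r * 2) r0.
rewrite ler_pMr// ler1n ltW// => /(_ isT isT).
rewrite mulrC mulfK ?gt_eqF//.
apply/negP; rewrite -ltNge.
have fB s : nu (ball x s) \is a fin_num.
  by apply: fin_num_measure; exact: measurable_ball_real.
have b0 : 0 < fine (nu (ball x r)).
  by rewrite fine_gt0// msupport_gt0//= ltey_eq fB.
apply: (@lt_le_trans _ _ (nu (ball x (2 * r)) / nu (ball x r))%E); last first.
  by apply: ereal_sup_ubound; exists x.
rewrite -(fineK (fB r)) inver gt_eqF// lte_pdivlMr//.
apply: (@lt_le_trans _ _ (nu [set e])); last first.
  apply: le_measure.
  - by rewrite inE; exact: measurable_set1.
  - by rewrite inE; exact: measurable_ball_real.
  - by move=> _ ->; rewrite -ball_normE /= distrC ltr_pMl// ltr1n.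
(* It remains to bound [nu (ball x r)] by the threshold in [hd], through inclusion in the punctured
   ball at [e]; the open ball misses [e], which lies at distance exactly [r] from [x]. *)
rewrite -(fineK fa) -EFinM lte_fin mulrC -ltr_pdivlMr// -lte_fin fineK//.
apply: le_lt_trans hd; apply: le_measure.
- by rewrite inE; exact: measurable_ball_real.
- by rewrite inE; apply: measurableD;
    [exact: measurable_ball_real|exact: measurable_set1].
- move=> y; rewrite -ball_normE /= => xy; split.
  + apply: le_lt_trans (ler_distD x e y) _; apply: lt_trans rd.
    by rewrite mulr_natr mulr2n ltrD2l.
  + by move=> ye; move: xy; rewrite ye /r distrC ltxx.
Qed.

(** Added mass cannot shrink the support. Conversely, a point off the closed support of [mu] has a
    [mu]-null open neighbourhood avoiding [e]. *)
Lemma msupport_add_dirac (R : realType)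
    (mu : {finite_measure set R -> \bar R}) (e : R) :
  closed (msupport mu) -> msupport mu e ->
  msupport (measure_add mu \d_e) = msupport mu.
Proof.
move=> cE Ee; apply/seteqP; split => x; last first.
  move=> sx U xU; rewrite /= measure_addE.
  by apply: lt_le_trans (sx U xU) _; rewrite leeDl.
move=> sx; apply: contrapT => nx.
have [U xU U0] : exists2 U, open_nbhs x U & (mu U <= 0)%E.
  apply: contrapT => h; apply: nx => U xU; rewrite ltNge; apply/negP => U0.
  by apply: h; exists U.
have oE : open_nbhs x (~` msupport mu) by split => //; exact: closed_openC.
(* Intersecting with the complement of the support removes [e], so the Dirac term vanishes. *)
have xV : open_nbhs x (U `&` ~` msupport mu) by exact: open_nbhsI.
have := sx _ xV; rewrite /= measure_addE [X in (_ + X)%E]diracE memNset; last by case.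
rewrite adde0; apply/negP; rewrite -leNgt; apply: le_trans U0.
apply: le_measure; rewrite ?inE.
- by apply: measurable_realfun.open_measurable; case: xV.
- by apply: measurable_realfun.open_measurable; case: xU.
- exact: subIsetl.
Qed.

Theorem mainTheorem4 (R : realType) (E : set R)
    (mu : {finite_measure set R -> \bar R}) (e : R) :
  compact E -> msupport mu = E -> E e ->
  [/\ msupport (measure_add mu \d_e) = E,
      lower_assouad_dim (measure_add mu \d_e) = 0%E &
      ~ isolated E e -> upper_assouad_dim (measure_add mu \d_e) = +oo%E].
Proof.
move=> cptE muE Ee.
have cE : closed E by apply: compact_closed => //; exact: norm_hausdorff.
have sE : msupport (measure_add mu \d_e) = E.
  by rewrite -muE; apply: msupport_add_dirac; rewrite muE.
have ae : (0 < measure_add mu \d_e [set e])%E.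
  rewrite measure_addE [X in (_ + X)%E]diracE mem_set//.
  by apply: (@lt_le_trans _ _ 1%E) => //; rewrite leeDr.
split=> //; first exact: lower_assouad_dim_atom ae.
move=> nI; apply: (upper_assouad_dim_atom _ _ e) => //; rewrite sE.
(* The closure of [E] consists of its isolated points and its limit points, so [e] is a limit
   point. *)
have := subset_closure Ee; rewrite closure_isolated_limit_point.
by case.
Qed.
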